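(* Let $m,n\ge2$ and $\mathcal{A}=(a_{i_1j_1i_2j_2})\in\mathbb{R}^{m\times n\times m\times n}$ be a biquadratic tensor. For $i\in[m]$ and $j\in[n]$ let $$r_{ij}=\frac14\sum_{i_1=1}^m\Big(\sum_{j_2=1}^n|\bar a_{i_1jij_2}|+\sum_{j_1=1}^n|\bar a_{i_1j_1ij}|\Big)+\frac14\sum_{i_2=1}^m\Big(\sum_{j_2=1}^n|\bar a_{iji_2j_2}|+\sum_{j_1=1}^n|\bar a_{ij_1i_2j}|\Big).$$ Then any M-eigenvalue $\lambda$ of $\mathcal{A}$ lies in one of the following $m$ intervals: $$\Big[\min_{j=1,\dots,n}\{a_{ijij}-r_{ij}\},\ \max_{j=1,\dots,n}\{a_{ijij}+r_{ij}\}\Big],\qquad i\in[m],$$ and in one of the following $n$ intervals: $$\Big[\min_{i=1,\dots,m}\{a_{ijij}-r_{ij}\},\ \max_{i=1,\dots,m}\{a_{ijij}+r_{ij}\}\Big],\qquad j\in[n].$$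
   Context: Write $[n]=\{1,\dots,n\}$. A biquadratic tensor is a real fourth-order tensor $\mathcal{A}=(a_{i_1j_1i_2j_2})\in\mathbb{R}^{m\times n\times m\times n}$, $i_1,i_2\in[m]$, $j_1,j_2\in[n]$, $m,n\ge2$ (no symmetry assumed). The entries $a_{ijij}$ are the diagonal entries, all others are off-diagonal. Set $\bar a_{i_1j_1i_2j_2}=a_{i_1j_1i_2j_2}$ if this is an off-diagonal entry, and $\bar a_{i_1j_1i_2j_2}=0$ if it is a diagonal entry. A real number $\lambda$ is an M-eigenvalue of $\mathcal{A}$ if there are real vectors $\mathbf{x}\in\mathbb{R}^m$, $\mathbf{y}\in\mathbb{R}^n$ with $\mathbf{x}^\top\mathbf{x}=\mathbf{y}^\top\mathbf{y}=1$ such that for every $i\in[m]$ $$\sum_{i_1=1}^m\sum_{j_1,j_2=1}^n a_{i_1j_1ij_2}x_{i_1}y_{j_1}y_{j_2}+\sum_{i_2=1}^m\sum_{j_1,j_2=1}^n a_{ij_1i_2j_2}y_{j_1}x_{i_2}y_{j_2}=2\lambda x_i,$$ and for every $j\in[n]$ $$\sum_{i_1,i_2=1}^m\sum_{j_1=1}^n a_{i_1j_1i_2j}x_{i_1}y_{j_1}x_{i_2}+\sum_{i_1,i_2=1}^m\sum_{j_2=1}^n a_{i_1ji_2j_2}x_{i_1}x_{i_2}y_{j_2}=2\lambda y_j.$$ *)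

(* Defs.v *)
From mathcomp Require Import all_boot all_order all_algebra.
From mathcomp Require Import reals.
Set Implicit Arguments.
Unset Strict Implicit.
Unset Printing Implicit Defensive.
Import Order.TTheory GRing.Theory Num.Theory.
Local Open Scope ring_scope.

(* A i1 j1 i2 j2 is the entry a_{i1 j1 i2 j2}. *)
Definition biquadratic_tensor (R : realType) (m n : nat) : Type :=
  'I_m -> 'I_n -> 'I_m -> 'I_n -> R.

Definition diagonal_index (m n : nat)
    (i1 : 'I_m) (j1 : 'I_n) (i2 : 'I_m) (j2 : 'I_n) : bool :=
  (i1 == i2) && (j1 == j2).

Definition offdiag (R : realType) (m n : nat) (A : biquadratic_tensor R m n) :
    biquadratic_tensor R m n :=
  fun i1 j1 i2 j2 =>
    if diagonal_index i1 j1 i2 j2 then 0 else A i1 j1 i2 j2.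

Definition M_eigenvalue (R : realType) (m n : nat)
    (A : biquadratic_tensor R m n) (lam : R) : Prop :=
  exists (x : 'cV[R]_m) (y : 'cV[R]_n),
    [/\ x^T *m x = 1%:M,
        y^T *m y = 1%:M,
        forall i : 'I_m,
          \sum_(i1 < m) \sum_(j1 < n) \sum_(j2 < n)
             A i1 j1 i j2 * x i1 0 * y j1 0 * y j2 0
          + \sum_(i2 < m) \sum_(j1 < n) \sum_(j2 < n)
             A i j1 i2 j2 * y j1 0 * x i2 0 * y j2 0
          = 2 * lam * x i 0
      & forall j : 'I_n,
          \sum_(i1 < m) \sum_(i2 < m) \sum_(j1 < n)
             A i1 j1 i2 j * x i1 0 * y j1 0 * x i2 0
          + \sum_(i1 < m) \sum_(i2 < m) \sum_(j2 < n)
             A i1 j i2 j2 * x i1 0 * x i2 0 * y j2 0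
          = 2 * lam * y j 0].

Definition radius (R : realType) (m n : nat) (A : biquadratic_tensor R m n)
    (i : 'I_m) (j : 'I_n) : R :=
  4^-1 * (\sum_(i1 < m) (\sum_(j2 < n) `|offdiag A i1 j i j2|
                         + \sum_(j1 < n) `|offdiag A i1 j1 i j|))
  + 4^-1 * (\sum_(i2 < m) (\sum_(j2 < n) `|offdiag A i j i2 j2|
                           + \sum_(j1 < n) `|offdiag A i j1 i2 j|)).

(* The iteration starts from the first value of F, so for 0 < k these are the
   true minimum and maximum of F (see min_ordP and max_ordP); for k = 0 both
   are 0. *)
Definition min_ord (R : realType) (k : nat) (F : 'I_k -> R) : R :=
  \big[Num.min/head 0 (codom F)]_(i < k) F i.

Definition max_ord (R : realType) (k : nat) (F : 'I_k -> R) : R :=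
  \big[Num.max/head 0 (codom F)]_(i < k) F i.

Lemma head_codom_ord (R : realType) (k : nat) (F : 'I_k -> R) :
  (0 < k)%N -> exists i, head 0 (codom F) = F i.
Proof.
case: k F => // k F _; exists ord0.
by rewrite codomE enum_ordSl.
Qed.

Lemma min_ordP (R : realType) (k : nat) (F : 'I_k -> R) : (0 < k)%N ->
  (exists i, min_ord F = F i) /\ (forall i, min_ord F <= F i).
Proof.
move=> k0; split; last by move=> i; exact: bigmin_le.
rewrite /min_ord; apply: (big_ind (fun v => exists i, v = F i)).
- exact: head_codom_ord.
- by move=> a b [i ->] [j ->]; case: (leP (F i) (F j)); [exists i|exists j].
- by move=> i _; exists i.
Qed.

Lemma max_ordP (R : realType) (k : nat) (F : 'I_k -> R) : (0 < k)%N ->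
  (exists i, max_ord F = F i) /\ (forall i, F i <= max_ord F).
Proof.
move=> k0; split; last by move=> i; exact: le_bigmax.
rewrite /max_ord; apply: (big_ind (fun v => exists i, v = F i)).
- exact: head_codom_ord.
- by move=> a b [i ->] [j ->]; case: (leP (F i) (F j)); [exists j|exists i].
- by move=> i _; exists i.
Qed.

(* Main.v *)
Require Import Defs.
From mathcomp Require Import all_boot all_order all_algebra.
From mathcomp Require Import reals.
From mathcomp Require Import ring lra.
Import Order.TTheory GRing.Theory Num.Theory.
Local Open Scope ring_scope.

(** The argument is Gershgorin's.  Let [x], [y] be unit vectors belonging to
    the M-eigenvalue [lam], and let [i] be an index at which [`|x i|] is
    maximal.  In the [i]-th eigenvalue equation the diagonal entries contribute
    [2 x_i \sum_j a_{ijij} y_j^2].  In the remaining terms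
    [`|x_{i1}| <= `|x_i|] and [`|y_{j1} y_{j2}| <= (y_{j1}^2 + y_{j2}^2) / 2],
    so their absolute value is at most [2 `|x_i| \sum_j r_{ij} y_j^2]
    ([gershgorin_row_sum] treats each of the two sums on the left-hand side).
    Dividing by [2 `|x_i|], which is nonzero, gives ([M_eigenvalue_row])
    [`|lam - \sum_j a_{ijij} y_j^2| <= \sum_j r_{ij} y_j^2].
    As the weights [y_j^2] sum to 1, [lam] lies between a convex combination of
    the [a_{ijij} - r_{ij}] and one of the [a_{ijij} + r_{ij}].

    The second family of intervals is the first one for the tensor with the
    roles of the two pairs of indices exchanged ([swap_tensor]), which has the
    same M-eigenvalues and the transposed radii. *)

(** Deviation of a trilinear sum from its diagonal part ([i1 = i], [j1 = j2])
    when the [i]-th coordinate of [x] is dominant. *)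
Lemma gershgorin_row_sum {R : realType} {m n : nat}
    (g : 'I_m -> 'I_n -> 'I_n -> R) (x : 'I_m -> R) (y : 'I_n -> R) (i : 'I_m)
    (B := fun (i1 : 'I_m) (j1 j2 : 'I_n) =>
            if (i1 == i) && (j1 == j2) then 0 else g i1 j1 j2) :
  (forall i1, `|x i1| <= `|x i|) ->
  `|\sum_(i1 < m) \sum_(j1 < n) \sum_(j2 < n) g i1 j1 j2 * (x i1 * y j1 * y j2)
    - x i * \sum_(j < n) y j ^+ 2 * g i j j|
  <= `|x i| * (2^-1 * \sum_(j < n) y j ^+ 2 *
       \sum_(i1 < m) (\sum_(j2 < n) `|B i1 j j2| + \sum_(j1 < n) `|B i1 j1 j|)).
Proof.
move=> xi_max.
(* Subtracting the diagonal part leaves the same sum with coefficients [B]. *)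
have -> : \sum_(i1 < m) \sum_(j1 < n) \sum_(j2 < n)
      g i1 j1 j2 * (x i1 * y j1 * y j2) - x i * \sum_(j < n) y j ^+ 2 * g i j j
    = \sum_(i1 < m) \sum_(j1 < n) \sum_(j2 < n)
        B i1 j1 j2 * (x i1 * y j1 * y j2).
  apply/eqP; rewrite subr_eq addrC; apply/eqP.
  rewrite [LHS](bigD1 i) // [X in _ = _ + X](bigD1 i) //= addrA; congr (_ + _).
    rewrite mulr_sumr -big_split /=; apply: eq_bigr => j _.
    rewrite (bigD1 j) // [X in _ = _ + X](bigD1 j) //= /B !eqxx /= mul0r add0r.
    congr (_ + _); first by ring.
    by apply: eq_bigr => j2; rewrite eq_sym => /negbTE ->.
  apply: eq_bigr => i1 /negbTE ne; apply: eq_bigr => j1 _.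
  by apply: eq_bigr => j2 _; rewrite /B ne.
have term i1 j1 j2 : `|B i1 j1 j2 * (x i1 * y j1 * y j2)| <=
    `|x i| * (2^-1 * (y j1 ^+ 2 * `|B i1 j1 j2| + y j2 ^+ 2 * `|B i1 j1 j2|)).
  have yy : `|y j1| * `|y j2| <= 2^-1 * (y j1 ^+ 2 + y j2 ^+ 2).
    rewrite -(real_normK (num_real (y j1))) -(real_normK (num_real (y j2))).
    have := sqr_ge0 (`|y j1| - `|y j2|); nra.
  have -> : `|x i| * (2^-1 * (y j1 ^+ 2 * `|B i1 j1 j2|
                               + y j2 ^+ 2 * `|B i1 j1 j2|))
          = `|B i1 j1 j2| * (`|x i| * (2^-1 * (y j1 ^+ 2 + y j2 ^+ 2))).
    by ring.
  rewrite !normrM -(mulrA `|x i1|).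
  by apply: ler_wpM2l => //; apply: ler_pM => //; exact: mulr_ge0.
apply: (@le_trans _ _ (\sum_(i1 < m) \sum_(j1 < n) \sum_(j2 < n) `|x i| *
    (2^-1 * (y j1 ^+ 2 * `|B i1 j1 j2| + y j2 ^+ 2 * `|B i1 j1 j2|)))).
  apply: le_trans (ler_norm_sum _ _ _) _; apply: ler_sum => i1 _.
  apply: le_trans (ler_norm_sum _ _ _) _; apply: ler_sum => j1 _.
  by apply: le_trans (ler_norm_sum _ _ _) _; apply: ler_sum => j2 _.
(* The two sides are now equal: the [y j1 ^+ 2] terms give the inner sums over
   [j2], and the [y j2 ^+ 2] terms those over [j1]. *)
under [X in _ <= _ * (_ * X)]eq_bigr => j _ do rewrite mulr_sumr.
rewrite [X in _ <= _ * (_ * X)]exchange_big /= !mulr_sumr le_eqVlt.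
apply/orP; left; apply/eqP; apply: eq_bigr => i1 _.
under eq_bigr => j1 _ do rewrite -!mulr_sumr big_split /=.
rewrite -!mulr_sumr big_split /= [X in _ + X]exchange_big /= -big_split /=.
congr (_ * (_ * _)); apply: eq_bigr => j _.
by rewrite mulrDr !mulr_sumr.
Qed.

Lemma unit_colP {R : realType} {k : nat} {x : 'cV[R]_k} :
  x^T *m x = 1%:M -> \sum_(i < k) x i 0 ^+ 2 = 1.
Proof.
move/matrixP/(_ 0 0); rewrite !mxE eqxx mulr1n => <-.
by apply: eq_bigr => i _; rewrite mxE expr2.
Qed.

(** A unit vector has a nonzero coordinate of maximal absolute value. *)
Lemma unit_col_dominant {R : realType} {k : nat} {x : 'cV[R]_k} :
  x^T *m x = 1%:M ->
  exists2 i, 0 < `|x i 0| & forall i1, `|x i1 0| <= `|x i 0|.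
Proof.
move=> /unit_colP xx.
case: (pickP (fun i => x i 0 != 0)) => [i0 xi0 | x0].
  have [i _ xi_max] := @Order.TotalTheory.arg_maxP _ _ _ i0 xpredT
    (fun i => `|x i 0|) isT.
  exists i; last by move=> i1; exact: xi_max.
  by apply: lt_le_trans (xi_max i0 isT); rewrite normr_gt0.
move: xx; rewrite big1 => [/eqP|i _]; first by rewrite eq_sym oner_eq0.
by move/negbFE/eqP: (x0 i) => ->; rewrite expr0n.
Qed.

(** The weights [w] are the squares of the coordinates of the eigenvector
    [y]. *)
Lemma M_eigenvalue_row {R : realType} {m n : nat}
    {A : biquadratic_tensor R m n} {lam : R} :
  M_eigenvalue A lam ->
  exists (i : 'I_m) (w : 'I_n -> R),
    [/\ forall j, 0 <= w j, \sum_(j < n) w j = 1 &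
        `|lam - \sum_(j < n) w j * A i j i j|
          <= \sum_(j < n) w j * radius A i j].
Proof.
move=> [x [y [xx yy eqx _]]].
have [i xi_gt0 xi_max] := unit_col_dominant xx.
exists i, (fun j => y j 0 ^+ 2); split=> [j||]; first exact: sqr_ge0.
  exact: unit_colP.
have H1 := gershgorin_row_sum (fun i1 j1 j2 => A i1 j1 i j2)
  (fun i1 => x i1 0) (fun j => y j 0) i xi_max.
have H2 := gershgorin_row_sum (fun i2 j1 j2 => A i j1 i2 j2)
  (fun i1 => x i1 0) (fun j => y j 0) i xi_max.
have := lerD H1 H2; move/(le_trans (ler_normD _ _)); rewrite -!mulrDr.
set S1 := \sum_(i1 < m) _; set S2 := \sum_(i1 < m) _.
set D := \sum_(j < n) _.
set r1 := \sum_(j < n) _; set r2 := \sum_(j < n) _.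
have -> : S1 - x i 0 * D + (S2 - x i 0 * D) = x i 0 * (2 * (lam - D)).
  have -> : S1 - x i 0 * D + (S2 - x i 0 * D) = S1 + S2 - 2 * (x i 0 * D).
    by ring.
  suff -> : S1 + S2 = 2 * lam * x i 0 by ring.
  rewrite -eqx /S1 /S2; congr (_ + _).
    apply: eq_bigr => i1 _; apply: eq_bigr => j1 _; apply: eq_bigr => j2 _.
    by ring.
  apply: eq_bigr => i1 _; apply: eq_bigr => j1 _; apply: eq_bigr => j2 _.
  by ring.
rewrite normrM ler_pM2l // normrM ger0_norm // => H.
suff -> : \sum_(j < n) y j 0 ^+ 2 * radius A i j = 4^-1 * (r1 + r2) by lra.
rewrite /r1 /r2 -big_split mulr_sumr; apply: eq_bigr => j _ /=.
rewrite -mulrDr /radius -mulrDr mulrCA; congr (_ * (_ * (_ + _))).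
apply: eq_bigr => i2 _; congr (_ + _); apply: eq_bigr => j2 _;
  by rewrite /offdiag /diagonal_index (eq_sym i).
Qed.

(** A number within the [w]-average of [r] of the [w]-average of [d] lies
    between the least [d - r] and the greatest [d + r]. *)
Lemma mem_itv_average {R : realType} {k : nat} {d r w : 'I_k -> R} {lam : R} :
  (0 < k)%N -> (forall j, 0 <= w j) -> \sum_(j < k) w j = 1 ->
  `|lam - \sum_(j < k) w j * d j| <= \sum_(j < k) w j * r j ->
  lam \in `[min_ord (fun j => d j - r j), max_ord (fun j => d j + r j)].
Proof.
move=> k_gt0 w_ge0 w1; rewrite ler_norml => /andP[lo hi].
have [_ minP] := @min_ordP _ _ (fun j => d j - r j) k_gt0.
have [_ maxP] := @max_ordP _ _ (fun j => d j + r j) k_gt0.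
rewrite in_itv /=; apply/andP; split.
  apply: (@le_trans _ _ (\sum_(j < k) w j * (d j - r j))).
    rewrite -[leLHS]mul1r -w1 mulr_suml.
    by apply: ler_sum => j _; apply: ler_wpM2l.
  by under eq_bigr => j _ do rewrite mulrBr; rewrite sumrB; lra.
apply: (@le_trans _ _ (\sum_(j < k) w j * (d j + r j))).
  by under eq_bigr => j _ do rewrite mulrDr; rewrite big_split /=; lra.
rewrite -[leRHS]mul1r -w1 mulr_suml.
by apply: ler_sum => j _; apply: ler_wpM2l.
Qed.

(** The tensor with the roles of the [m]-indices and the [n]-indices
    exchanged. *)
Definition swap_tensor {R : realType} {m n : nat}
    (A : biquadratic_tensor R m n) : biquadratic_tensor R n m :=
  fun j1 i1 j2 i2 => A i1 j1 i2 j2.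

Lemma radius_swap {R : realType} {m n : nat} (A : biquadratic_tensor R m n)
    (i : 'I_m) (j : 'I_n) :
  radius (swap_tensor A) j i = radius A i j.
Proof.
have off i1 j1 i2 j2 :
    offdiag (swap_tensor A) j1 i1 j2 i2 = offdiag A i1 j1 i2 j2.
  by rewrite /offdiag /diagonal_index andbC.
(* [f] lists the four indices at which the entry is read as the two summation
   indices vary. *)
have offE (f : 'I_n -> 'I_m -> 'I_n * 'I_m * ('I_n * 'I_m)) :
    \sum_(j1 < n) \sum_(i1 < m) `|offdiag (swap_tensor A)
        (f j1 i1).1.1 (f j1 i1).1.2 (f j1 i1).2.1 (f j1 i1).2.2|
    = \sum_(i1 < m) \sum_(j1 < n) `|offdiag A
        (f j1 i1).1.2 (f j1 i1).1.1 (f j1 i1).2.2 (f j1 i1).2.1|.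
  rewrite exchange_big; apply: eq_bigr => i1 _; apply: eq_bigr => j1 _.
  by rewrite off.
(* Swapping permutes the four double sums of the radius: the first and the
   fourth are exchanged, the second and the third are kept. *)
rewrite /radius !big_split /=.
rewrite (offE (fun j1 i1 => ((j1, i), (j, i1)))).
rewrite (offE (fun j1 i1 => ((j1, i1), (j, i)))).
rewrite (offE (fun j1 i1 => ((j, i), (j1, i1)))).
rewrite (offE (fun j1 i1 => ((j, i1), (j1, i)))) /=.
by ring.
Qed.

Lemma M_eigenvalue_swap {R : realType} {m n : nat}
    {A : biquadratic_tensor R m n} {lam : R} :
  M_eigenvalue A lam -> M_eigenvalue (swap_tensor A) lam.
Proof.
move=> [x [y [xx yy eqx eqy]]]; exists y, x; split=> // [j|i].
- rewrite -eqy /swap_tensor; congr (_ + _); rewrite exchange_big /=;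
    apply: eq_bigr => i1 _; rewrite exchange_big /=; apply: eq_bigr => i2 _;
    by apply: eq_bigr => j1 _; ring.
- rewrite -eqx /swap_tensor; congr (_ + _); rewrite [RHS]exchange_big /=;
    apply: eq_bigr => j1 _; rewrite [RHS]exchange_big /=; apply: eq_bigr => j2 _;
    by apply: eq_bigr => i1 _; ring.
Qed.

Theorem theorem4p1 (R : realType) (m n : nat) (hm : (2 <= m)%N) (hn : (2 <= n)%N)
    (A : biquadratic_tensor R m n) (lam : R) (hlam : M_eigenvalue A lam) :
  (exists i : 'I_m,
     lam \in `[min_ord (fun j : 'I_n => A i j i j - radius A i j),
               max_ord (fun j : 'I_n => A i j i j + radius A i j)])
  /\
  (exists j : 'I_n,
     lam \in `[min_ord (fun i : 'I_m => A i j i j - radius A i j),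
               max_ord (fun i : 'I_m => A i j i j + radius A i j)]).
Proof.
have m_gt0 : (0 < m)%N := ltnW hm.
have n_gt0 : (0 < n)%N := ltnW hn.
split.
  have [i [w [w_ge0 w1 bound]]] := M_eigenvalue_row hlam.
  by exists i; exact: mem_itv_average bound.
have [j [w [w_ge0 w1]]] := M_eigenvalue_row (M_eigenvalue_swap hlam).
under [leRHS]eq_bigr => i _ do rewrite radius_swap.
by exists j; apply: mem_itv_average.
Qed.
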